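(* For a bounded distributive lattice $S$, regarded as a semiring, the following conditions are equivalent: (1) All finitely generated $S$-semimodules are e-injective. (2) All cyclic $S$-semimodules are e-injective. (3) $S$ is a finite Boolean algebra.
   Context: A bounded distributive lattice is a commutative semiring with join as addition, meet as multiplication, $0$ the least and $1$ the greatest element. A semiring is $(S,+,\cdot,0,1)$ with $(S,+,0)$ a commutative monoid, $(S,\cdot,1)$ a monoid, multiplication distributing over addition on both sides, and $0s=0=s0$ for all $s$. A (left) $S$-semimodule is a commutative monoid $(M,+,0)$ with a scalar multiplication $S\times M\to M$ satisfying $(ss')m=s(s'm)$, $s(m+m')=sm+sm'$, $(s+s')m=sm+s'm$, $1m=m$, $s0=0=0m$. Homomorphisms preserve $+$, $0$ and scalar multiplication; ${}_S\mathcal{M}$ is the category of left $S$-semimodules and $\mathcal{M}$ the category of commutative monoids. A semimodule is cyclic (finitely generated) if it is a homomorphic image of ${}_SS$ (of $({}_SS)^n$ for some finite $n$). A sequence $0\to A\xrightarrow{f}B\xrightarrow{g}C\to 0$ in ${}_S\mathcal{M}$ (or in $\mathcal{M}$) is short exact if $f$ is a categorical kernel of $g$ and $g$ is a categorical cokernel of $f$ (kernels and cokernels in the sense of categories with zero morphisms). $M\in{}_S\mathcal{M}$ is e-injective if the contravariant functor $\mathrm{Hom}_S(-,M):{}_S\mathcal{M}\to\mathcal{M}$ sends every short exact sequence $0\to A\to B\to C\to 0$ to a short exact sequence $0\to\mathrm{Hom}_S(C,M)\to\mathrm{Hom}_S(B,M)\to\mathrm{Hom}_S(A,M)\to 0$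 in $\mathcal{M}$. *)

(* Defs.v *)
From HB Require Import structures.
From mathcomp Require Import all_boot all_order all_algebra.
From mathcomp Require Import boolp classical_sets cardinality.

Set Implicit Arguments.
Unset Strict Implicit.
Unset Printing Implicit Defensive.

Import Order.TTheory GRing.Theory.
Local Open Scope ring_scope.

(* An alias, so that the semiring operations below do not become canonical on
   every lattice. The one-element lattice is allowed, hence a "Pz" (possibly
   zero) semiring. *)
Definition lattice_semiring (d : Order.disp_t) (S : tbDistrLatticeType d) :
  Type := S.

Section LatticeSemiring.
Context (d : Order.disp_t) (S : tbDistrLatticeType d).

HB.instance Definition _ := Choice.on (lattice_semiring S).

HB.instance Definition _ := GRing.isNmodule.Build (lattice_semiring S)
  (@joinA d S) (@joinC d S) (@join0x d S).

HB.instance Definition _ := GRing.Nmodule_isComPzSemiRing.Build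
  (lattice_semiring S)
  (@meetA d S) (@meetC d S) (@meet1x d S) (@meetUl d S) (@meet0x d S).

Lemma lattice_semiring_addE (x y : lattice_semiring S) :
  x + y = Order.join (x : S) (y : S).
Proof. by []. Qed.

Lemma lattice_semiring_mulE (x y : lattice_semiring S) :
  x * y = Order.meet (x : S) (y : S).
Proof. by []. Qed.

Lemma lattice_semiring_0E : (0 : lattice_semiring S) = (\bot%O : S).
Proof. by []. Qed.

Lemma lattice_semiring_1E : (1 : lattice_semiring S) = (\top%O : S).
Proof. by []. Qed.

End LatticeSemiring.

(* Over a semiring, {linear A -> B} consists of the maps preserving 0, + and
   scalar multiplication. Equality of morphisms is written pointwise (=1). *)

Definition smod_kernel (S : pzSemiRingType) (A B C : lSemiModType S)
    (f : {linear A -> B}) (g : {linear B -> C}) : Prop :=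
  (forall a, g (f a) = 0) /\
  forall (X : lSemiModType S) (h : {linear X -> B}),
    (forall x, g (h x) = 0) ->
    exists2 u : {linear X -> A}, f \o u =1 h &
      forall v : {linear X -> A}, f \o v =1 h -> v =1 u.

Definition smod_cokernel (S : pzSemiRingType) (A B C : lSemiModType S)
    (f : {linear A -> B}) (g : {linear B -> C}) : Prop :=
  (forall a, g (f a) = 0) /\
  forall (X : lSemiModType S) (h : {linear B -> X}),
    (forall a, h (f a) = 0) ->
    exists2 u : {linear C -> X}, u \o g =1 h &
      forall v : {linear C -> X}, v \o g =1 h -> v =1 u.

Definition smod_short_exact (S : pzSemiRingType) (A B C : lSemiModType S)
    (f : {linear A -> B}) (g : {linear B -> C}) : Prop :=
  smod_kernel f g /\ smod_cokernel f g.

Definition cmon_kernel (A B C : nmodType)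
    (f : {additive A -> B}) (g : {additive B -> C}) : Prop :=
  (forall a, g (f a) = 0) /\
  forall (X : nmodType) (h : {additive X -> B}),
    (forall x, g (h x) = 0) ->
    exists2 u : {additive X -> A}, f \o u =1 h &
      forall v : {additive X -> A}, f \o v =1 h -> v =1 u.

Definition cmon_cokernel (A B C : nmodType)
    (f : {additive A -> B}) (g : {additive B -> C}) : Prop :=
  (forall a, g (f a) = 0) /\
  forall (X : nmodType) (h : {additive B -> X}),
    (forall a, h (f a) = 0) ->
    exists2 u : {additive C -> X}, u \o g =1 h &
      forall v : {additive C -> X}, v \o g =1 h -> v =1 u.

Definition cmon_short_exact (A B C : nmodType)
    (f : {additive A -> B}) (g : {additive B -> C}) : Prop :=
  cmon_kernel f g /\ cmon_cokernel f g.

Definition smod_hom (S : pzSemiRingType) (A M : lSemiModType S) : Type :=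
  {linear A -> M}.

Lemma linear_eqP (S : pzSemiRingType) (A M : lSemiModType S)
  (f g : {linear A -> M}) : f =1 g -> f = g.
Proof.
move: f g => [f [[cf0] [cf1]]] [g [[cg0] [cg1]]] /= /funext fg.
move: fg cf0 cf1 cg0 cg1 => /= -> *.
by do 4?f_equal; exact: Prop_irrelevance.
Qed.

Section HomMonoid.
Context (S : pzSemiRingType) (A M : lSemiModType S).

Definition smod_hom_zero : smod_hom A M := (\0 : {linear A -> M}).
Definition smod_hom_add (f g : smod_hom A M) : smod_hom A M :=
  ((f : {linear A -> M}) \+ (g : {linear A -> M}) : {linear A -> M}).

Lemma smod_hom_addA : associative smod_hom_add.
Proof. by move=> f g h; apply: linear_eqP => a /=; rewrite addrA. Qed.

Lemma smod_hom_addC : commutative smod_hom_add.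
Proof. by move=> f g; apply: linear_eqP => a /=; rewrite addrC. Qed.

Lemma smod_hom_add0 : left_id smod_hom_zero smod_hom_add.
Proof. by move=> f; apply: linear_eqP => a /=; rewrite add0r. Qed.

HB.instance Definition _ := gen_eqMixin (smod_hom A M).
HB.instance Definition _ := gen_choiceMixin (smod_hom A M).
HB.instance Definition _ := GRing.isNmodule.Build (smod_hom A M)
  smod_hom_addA smod_hom_addC smod_hom_add0.

End HomMonoid.

(* The action of Hom_S(-, M) on morphisms. *)
Definition smod_hom_map (S : pzSemiRingType) (M A B : lSemiModType S)
    (f : {linear A -> B}) (h : smod_hom B M) : smod_hom A M :=
  ((h : {linear B -> M}) \o f : {linear A -> M}).

Section HomMap.
Context (S : pzSemiRingType) (M A B : lSemiModType S) (f : {linear A -> B}).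

Lemma smod_hom_map_is_additive :
  nmod_morphism (smod_hom_map f : smod_hom B M -> smod_hom A M).
Proof. by split=> [|h k]; apply: linear_eqP. Qed.

HB.instance Definition _ := GRing.isNmodMorphism.Build
  (smod_hom B M) (smod_hom A M) (smod_hom_map f) smod_hom_map_is_additive.

End HomMap.

Definition e_injective (S : pzSemiRingType) (M : lSemiModType S) : Prop :=
  forall (A B C : lSemiModType S) (f : {linear A -> B}) (g : {linear B -> C}),
    smod_short_exact f g ->
    cmon_short_exact
      (smod_hom_map g : {additive smod_hom C M -> smod_hom B M})
      (smod_hom_map f : {additive smod_hom B M -> smod_hom A M}).

Definition cyclic_smod (S : pzSemiRingType) (M : lSemiModType S) : Prop :=
  exists p : {linear S^o -> M}, forall m, exists s, p s = m.

Definition fingen_smod (S : pzSemiRingType) (M : lSemiModType S) : Prop :=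
  exists (n : nat) (p : {linear {ffun 'I_n -> S^o} -> M}),
    forall m, exists s, p s = m.

Definition finite_boolean_algebra (d : Order.disp_t) (S : tbDistrLatticeType d)
    : Prop :=
  finite_set [set: S] /\
  forall x : S, exists y : S,
    Order.meet x y = \bot%O /\ Order.join x y = \top%O.

(* Main.v *)
Require Import Defs.
From HB Require Import structures.
From mathcomp Require Import all_boot all_order all_algebra.
From mathcomp Require Import boolp classical_sets cardinality.
From mathcomp Require Import zify.

(* (3) => (1): over a finite Boolean algebra, 1 is the sum of the atoms e, and a
   finitely generated semimodule M has a greatest element T. If f : A -> B is a
   kernel of g, a map h : A -> M extends to B by
     b |-> sum over e of (h (f^-1 (e b)) if g (e b) = 0, and e T otherwise),
   and the extension k of the zero map satisfies h + k = h' + k whenever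
   h, h' : B -> M agree on A; with the universal property of the cokernel g this
   is e-injectivity of M.

   (2) => (3): every lattice ideal I gives a short exact sequence I -> S -> S/I.
   For M = S and I = {y | y <= x}, the identity and multiplication by x agree on
   I, hence they are equal modulo the annihilator of x, which yields a complement
   of x. For M = S/I and a subset G of S, let D consist of the x with x G inside
   I and J of the y with y D inside I. The map d + j |-> d from D + J to S/I
   extends to S, which says that D has a greatest element modulo I. With I = 0
   this gives suprema. If S were infinite, it would contain pairwise disjoint
   nonzero elements a_(i,j); take for I the elements disjoint from almost all
   a_(i,j) and for G the suprema of the columns (a_(i,j))_j: a supremum of one
   well-chosen element in each column contradicts maximality. *)

Set Implicit Arguments.
Unset Strict Implicit.
Unset Printing Implicit Defensive.

Import Order.TTheory GRing.Theory.
Local Open Scope ring_scope.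
Local Open Scope quotient_scope.

Definition linear_pack (R : pzSemiRingType) (A B : lSemiModType R) (f : A -> B)
    (lin_f : semilinear_for *:%R f) : {linear A -> B} :=
  HB.pack f (GRing.isSemilinear.Build R A B *:%R f lin_f).

Definition additive_pack (A B : nmodType) (f : A -> B)
    (add_f : nmod_morphism f) : {additive A -> B} :=
  HB.pack f (GRing.isNmodMorphism.Build A B f add_f).

(** * Subtractive subsemimodules and Bourne quotients *)

Record subtractive (R : pzSemiRingType) (B : lSemiModType R) := Subtractive {
  sub_carrier :> B -> Prop;
  sub_carrier0 : sub_carrier 0;
  sub_carrierD : forall x y,
    sub_carrier x -> sub_carrier y -> sub_carrier (x + y);
  sub_carrierZ : forall s x, sub_carrier x -> sub_carrier (s *: x);
  sub_carrierB : forall x y,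
    sub_carrier (x + y) -> sub_carrier y -> sub_carrier x }.

Section SubtractiveQuotient.
Context (R : pzSemiRingType) (B : lSemiModType R) (I : subtractive B).

Definition subtractive_type : Type := {x : B | `[< I x >]}.

HB.instance Definition _ := SubChoice.on subtractive_type.

Lemma subtractive_closed : subsemimod_closed (fun x => `[< I x >]).
Proof.
split; first split.
- exact/asboolP/sub_carrier0.
- by move=> x y /asboolP Ix /asboolP Iy; apply/asboolP/sub_carrierD.
- by move=> s x /asboolP Ix; apply/asboolP/sub_carrierZ.
Qed.

HB.instance Definition _ :=
  GRing.SubChoice_isSubLSemiModule.Build R B (fun x => `[< I x >])
    subtractive_type subtractive_closed.

Definition subtractive_incl (a : subtractive_type) : B := val a.

Lemma subtractive_incl_linear : semilinear_for *:%R subtractive_incl.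
Proof. by split=> *. Qed.

HB.instance Definition _ :=
  GRing.isSemilinear.Build R subtractive_type B *:%R subtractive_incl
    subtractive_incl_linear.

Lemma subtractive_inclP (a : subtractive_type) : I (subtractive_incl a).
Proof. by case: a => x Ix; apply/asboolP. Qed.

(** Without subtraction, membership of x - y in I becomes equality up to adding elements of I; this
    is the least congruence collapsing I to 0. *)
Definition bourne : rel B :=
  fun x y => `[< exists2 a, I a & exists2 b, I b & x + a = y + b >].

Lemma bourne_is_equiv : equiv_class_of bourne.
Proof.
split.
- by move=> x; apply/asboolP; exists 0; [|exists 0] => //; apply: sub_carrier0.
- by move=> x y; apply/asboolP/asboolP => -[a Ia [b Ib e]];
    exists b => //; exists a.
- move=> y x z /asboolP[a Ia [b Ib e]] /asboolP[c Ic [d Id e']].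
  apply/asboolP; exists (a + c); first exact: sub_carrierD.
  exists (b + d); first exact: sub_carrierD.
  by rewrite addrA e addrAC e' -addrA [d + b]addrC.
Qed.

Canonical bourne_equiv := EquivRelPack bourne_is_equiv.

Definition bourne_quotient : Type := {eq_quot bourne_equiv}.

HB.instance Definition _ := Choice.on bourne_quotient.
HB.instance Definition _ := Quotient.on bourne_quotient.

Definition bourne_pi (x : B) : bourne_quotient := \pi_bourne_quotient x.

Lemma bourne_piP x y :
  bourne_pi x = bourne_pi y <->
  exists2 a, I a & exists2 b, I b & x + a = y + b.
Proof. by split=> [/eqmodP/asboolP|?] //; apply/eqmodP/asboolP. Qed.

Lemma bourne_piK : cancel repr bourne_pi.
Proof. exact: reprK. Qed.

Definition bourne_zero := bourne_pi 0.
Definition bourne_add (p q : bourne_quotient) := bourne_pi (repr p + repr q).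
Definition bourne_scale (s : R) (p : bourne_quotient) :=
  bourne_pi (s *: repr p).

Lemma bourne_piD x y :
  bourne_pi (x + y) = bourne_add (bourne_pi x) (bourne_pi y).
Proof.
rewrite /bourne_add.
have /bourne_piP[a Ia [b Ib e]] := bourne_piK (bourne_pi x).
have /bourne_piP[c Ic [d Id e']] := bourne_piK (bourne_pi y).
apply/bourne_piP; exists (b + d); first exact: sub_carrierD.
exists (a + c); first exact: sub_carrierD.
by rewrite addrACA -e -e' addrACA.
Qed.

Lemma bourne_piZ s x : bourne_pi (s *: x) = bourne_scale s (bourne_pi x).
Proof.
have /bourne_piP[a Ia [b Ib e]] := bourne_piK (bourne_pi x).
apply/bourne_piP; exists (s *: b); first exact: sub_carrierZ.
by exists (s *: a); [exact: sub_carrierZ|rewrite -!scalerDr e].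
Qed.

Lemma bourne_ind (P : bourne_quotient -> Prop) :
  (forall x, P (bourne_pi x)) -> forall p, P p.
Proof. by move=> Ppi p; rewrite -(bourne_piK p). Qed.

Lemma bourne_addA : associative bourne_add.
Proof.
move=> p q r; elim/bourne_ind: p => x; elim/bourne_ind: q => y.
by elim/bourne_ind: r => z; rewrite -!bourne_piD addrA.
Qed.

Lemma bourne_addC : commutative bourne_add.
Proof.
move=> p q; elim/bourne_ind: p => x; elim/bourne_ind: q => y.
by rewrite -!bourne_piD addrC.
Qed.

Lemma bourne_add0 : left_id bourne_zero bourne_add.
Proof. by move=> p; elim/bourne_ind: p => x; rewrite -bourne_piD add0r. Qed.

HB.instance Definition _ := GRing.isNmodule.Build bourne_quotient
  bourne_addA bourne_addC bourne_add0.

Lemma bourne_scaleA a b p :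
  bourne_scale a (bourne_scale b p) = bourne_scale (a * b) p.
Proof. by elim/bourne_ind: p => x; rewrite -!bourne_piZ scalerA. Qed.

Lemma bourne_scale0 p : bourne_scale 0 p = 0.
Proof. by elim/bourne_ind: p => x; rewrite -bourne_piZ scale0r. Qed.

Lemma bourne_scale1 : left_id 1 bourne_scale.
Proof. by move=> p; elim/bourne_ind: p => x; rewrite -bourne_piZ scale1r. Qed.

Lemma bourne_scaleDr : right_distributive bourne_scale +%R.
Proof.
move=> s p q; elim/bourne_ind: p => x; elim/bourne_ind: q => y.
by rewrite -[bourne_pi x + _]bourne_piD -!bourne_piZ scalerDr bourne_piD.
Qed.

Lemma bourne_scaleDl p : {morph bourne_scale^~ p : a b / a + b}.
Proof.
move=> a b; elim/bourne_ind: p => x.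
by rewrite -!bourne_piZ scalerDl bourne_piD.
Qed.

HB.instance Definition _ := GRing.Nmodule_isLSemiModule.Build R bourne_quotient
  bourne_scaleA bourne_scale0 bourne_scale1 bourne_scaleDr bourne_scaleDl.

HB.instance Definition _ :=
  GRing.isSemilinear.Build R B bourne_quotient *:%R bourne_pi
    (bourne_piZ, bourne_piD).

(** From x + a = b with a and b in I, subtractivity puts x in I: the class of 0 does not outgrow
    I. *)
Lemma bourne_pi_eq0 x : bourne_pi x = 0 <-> I x.
Proof.
split=> [/bourne_piP[a Ia [b Ib]]|Ix].
  by rewrite add0r => e; apply: sub_carrierB Ia; rewrite e.
apply/bourne_piP; exists 0; first exact: sub_carrier0.
by exists x; rewrite // addr0 add0r.
Qed.

Lemma subtractive_short_exact :
  smod_short_exact (subtractive_incl : {linear subtractive_type -> B})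
                   (bourne_pi : {linear B -> bourne_quotient}).
Proof.
have pi_incl (a : subtractive_type) : bourne_pi (subtractive_incl a) = 0.
  exact/bourne_pi_eq0/subtractive_inclP.
split; split=> // X h h0.
  have Ih x : I (h x) by apply/bourne_pi_eq0; apply: h0.
  pose u x : subtractive_type := exist _ (h x) (asboolT (Ih x)).
  have lin_u : semilinear_for *:%R u.
    by split=> [s x|x y]; apply: val_inj; rewrite /= ?linearZ ?linearD.
  by exists (linear_pack lin_u) => // v vh x; apply: val_inj; apply: vh.
have hI x : I x -> h x = 0.
  by move=> Ix; apply: (h0 (exist _ x (asboolT Ix))).
(* The choice of representative is harmless, as h kills the elements of I added on either side. *)
pose u (p : bourne_quotient) : X := h (repr p).
have uE x : u (bourne_pi x) = h x.
  have /bourne_piP[a Ia [b Ib e]] := bourne_piK (bourne_pi x).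
  by rewrite -[RHS]addr0 -(hI _ Ib) -linearD -e linearD (hI _ Ia) addr0.
have lin_u : semilinear_for *:%R u.
  split=> [s p|p q]; elim/bourne_ind: p => x.
    by rewrite -[s *: bourne_pi x]linearZ !uE linearZ.
  by elim/bourne_ind: q => y; rewrite -[bourne_pi x + _]raddfD !uE raddfD.
exists (linear_pack lin_u) => // v vh p; elim/bourne_ind: p => x.
exact: etrans (vh x) (esym (uE x)).
Qed.

End SubtractiveQuotient.

(** * Cokernels of monoids and extension of maps *)

(* A cokernel g factors through the submonoid im g, so by uniqueness the inclusion
   of im g has a section. *)
Lemma cmon_cokernel_surj (A B C : nmodType) (f : {additive A -> B})
    (g : {additive B -> C}) (c : C) : cmon_cokernel f g -> exists b, g b = c.
Proof.
move=> [gf0 univ].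
pose T := {z : C | `[< exists b, g b = z >]}.
have closT : Algebra.nmod_closed (fun z : C => `[< exists b, g b = z >]).
  split=> [|_ _ /asboolP[x <-] /asboolP[y <-]]; apply/asboolP.
    by exists 0; rewrite raddf0.
  by exists (x + y); rewrite raddfD.
pose im : nmodType :=
    HB.pack T (GRing.SubChoice_isSubNmodule.Build C _ T closT).
pose g' (b : B) : im := exist _ (g b) (asboolT (ex_intro _ b erefl)).
have add_g' : nmod_morphism g'.
  by split=> [|x y]; apply: val_inj; rewrite /= ?raddf0 ?raddfD.
pose i (z : im) : C := sval z.
have add_i : nmod_morphism i by [].
have [a|u ug' _] := univ im (additive_pack add_g').
  by apply: val_inj; apply: gf0.
have [a|w _ w_uniq] := univ C g; first exact: gf0.
have : (additive_pack add_i \o u) c = c.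
  rewrite (w_uniq (additive_pack add_i \o u : {additive C -> C})).
    by rewrite -(w_uniq (idfun : {additive C -> C})).
  by move=> b /=; rewrite [u _]ug'.
by move=> /= <-; rewrite /i; case: (u c) => z /= /asboolP.
Qed.

(** Restriction to I is a cokernel of commutative monoids, hence surjective. *)
Lemma e_injective_extend (R : pzSemiRingType) (M B : lSemiModType R)
    (I : subtractive B) (h : {linear subtractive_type I -> M}) :
  e_injective M ->
  exists H : {linear B -> M}, H \o @subtractive_incl R B I =1 h.
Proof.
move=> injM; have [_ coker] := injM _ _ _ _ _ (subtractive_short_exact I).
have [H Hh] := cmon_cokernel_surj (h : smod_hom _ _) coker.
by exists H => a; rewrite -Hh.
Qed.

Section ScaleBy.
Context (R : comPzSemiRingType) (M : lSemiModType R).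

Lemma scale_by_linear (m : M) :
  semilinear_for *:%R (fun s : R^o => (s : R) *: m).
Proof. by split=> [s t|s t]; rewrite ?scalerDl ?scalerA. Qed.

Definition scale_by (m : M) : {linear R^o -> M} :=
  linear_pack (scale_by_linear m).

End ScaleBy.

Lemma cyclic_regular (R : pzSemiRingType) : cyclic_smod (R^o : lSemiModType R).
Proof. by exists (idfun : {linear R^o -> R^o}) => m; exists m. Qed.

Lemma cyclic_bourne (R : pzSemiRingType)
    (I : subtractive (R^o : lSemiModType R)) :
  cyclic_smod (bourne_quotient I).
Proof.
exists (@bourne_pi R R^o I : {linear R^o -> bourne_quotient I}) => m.
by exists (repr m); apply: bourne_piK.
Qed.

(** * Lattice ideals, complements and pseudocomplements *)

Section LatticeIdeals.
Context (d : Order.disp_t) (S : tbDistrLatticeType d).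
Local Notation L := (lattice_semiring S).

Lemma lat_mulxx (x : L) : x * x = x. Proof. exact: meetxx. Qed.
Lemma lat_add1x (x : L) : 1 + x = 1. Proof. exact: join1x. Qed.
Lemma lat_mulKD (x y : L) : x * (x + y) = x. Proof. exact: joinKI. Qed.

Lemma smod_addxx (M : lSemiModType L) (m : M) : m + m = m.
Proof. by rewrite -[m]scale1r -scalerDl lat_add1x. Qed.

Lemma smod_eq0_add (M : lSemiModType L) (m n : M) : m + n = 0 -> m = 0.
Proof. by move=> mn0; rewrite -[LHS]addr0 -mn0 addrA smod_addxx. Qed.

(** By absorption x = x (x + y), so x is a multiple of x + y. *)
Lemma lattice_ideal_subtractive (P : L -> Prop) :
  (forall s x, P x -> P (s * x)) -> forall x y, P (x + y) -> P y -> P x.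
Proof. by move=> PM x y Pxy _; rewrite -[x](lat_mulKD x y); apply: PM. Qed.

Definition lattice_ideal (P : L -> Prop) (P0 : P 0)
    (PD : forall x y, P x -> P y -> P (x + y))
    (PM : forall s x, P x -> P (s * x)) : subtractive (L^o : lSemiModType L) :=
  @Subtractive L L^o P P0 PD PM (lattice_ideal_subtractive PM).

Lemma complemented_of_e_injective :
  e_injective (L^o : lSemiModType L) ->
  forall x : L, exists y : L, x * y = 0 /\ x + y = 1.
Proof.
move=> injL x.
have downD y z : y * x = y -> z * x = z -> (y + z) * x = y + z.
  by rewrite mulrDl => -> ->.
have downM s y : y * x = y -> s * y * x = s * y by rewrite -mulrA => ->.
pose I := lattice_ideal (mul0r x) downD downM.
have annD y z : y * x = 0 -> z * x = 0 -> (y + z) * x = 0.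
  by rewrite mulrDl => -> ->; rewrite addr0.
have annM s y : y * x = 0 -> s * y * x = 0.
  by rewrite -mulrA => ->; rewrite mulr0.
pose N := lattice_ideal (mul0r x) annD annM.
(* Testing the cokernel property against L/N replaces a description of the cokernel
   in commutative monoids. *)
pose psi (h : smod_hom L^o L^o) : bourne_quotient N :=
  bourne_pi N ((h : {linear L^o -> L^o}) 1).
have add_psi : nmod_morphism psi.
  by split=> [|h k]; rewrite /psi /= ?raddf0 ?raddfD.
have [_ [_ univ]] := injL _ _ _ _ _ (subtractive_short_exact I).
(* A map factoring through S/I kills x, so its value at 1 annihilates x and [psi] sends it to 0. *)
have [k|u uE _] := univ _ (additive_pack add_psi).
  apply/bourne_pi_eq0 => /=.
  have : (k : {linear _ -> L^o}) (bourne_pi I (x * 1)) = 0.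
    rewrite (_ : bourne_pi I _ = 0) ?raddf0 //.
    by apply/bourne_pi_eq0; rewrite /= mulr1 lat_mulxx.
  by rewrite [bourne_pi I _]linearZ linearZ /= mulrC.
pose id_hom : smod_hom L^o L^o := (idfun : {linear L^o -> L^o}).
pose mulx : smod_hom L^o L^o := scale_by (x : L^o).
have agree : smod_hom_map (@subtractive_incl _ _ I) id_hom =
             smod_hom_map (@subtractive_incl _ _ I) mulx.
  by apply: linear_eqP => a /=; rewrite [RHS](subtractive_inclP a).
have := uE id_hom; rewrite /= agree [u _](uE mulx) /=.
(* The classes of 1 and x modulo N coincide: x + a = 1 + b = 1, with a annihilating x. *)
move=> /bourne_piP[a Na [b _ e]]; exists a; split; first by rewrite mulrC.
by rewrite -[RHS](lat_add1x b) -[RHS]e; congr (_ + _); rewrite [RHS]scale1r.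
Qed.

(* k represents the greatest x modulo I such that x * g lies in I for all g. *)
Lemma pseudocomplement_modulo :
  (forall M : lSemiModType L, cyclic_smod M -> e_injective M) ->
  forall (I : subtractive (L^o : lSemiModType L)) (G : L -> Prop),
  exists k : L, (forall g, G g -> I (g * k)) /\
    forall x, (forall g, G g -> I (x * g)) -> exists2 i, I i & x * (k + i) = x.
Proof.
move=> inj I G.
have I0 : I 0 := sub_carrier0 I.
have ID (x y : L) : I x -> I y -> I (x + y) := @sub_carrierD _ _ I x y.
have IM (s x : L) : I x -> I (s * x) := @sub_carrierZ _ _ I s x.
pose D x := forall g, G g -> I (x * g).
pose J y := forall x, D x -> I (y * x).
have D0 : D 0 by move=> g _; rewrite mul0r.
have J0 : J 0 by move=> g _; rewrite mul0r.
have DD x y : D x -> D y -> D (x + y).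
  by move=> Dx Dy g Gg; rewrite mulrDl; apply: ID; [apply: Dx|apply: Dy].
have JD x y : J x -> J y -> J (x + y).
  by move=> Jx Jy g Gg; rewrite mulrDl; apply: ID; [apply: Jx|apply: Jy].
have DM s x : D x -> D (s * x).
  by move=> Dx g Gg; rewrite -mulrA; apply/IM/Dx.
have JM s x : J x -> J (s * x).
  by move=> Jx g Gg; rewrite -mulrA; apply/IM/Jx.
pose P z := exists2 x, D x & exists2 y, J y & z = x + y.
have P0 : P 0 by exists 0 => //; exists 0; rewrite ?addr0.
have PD z z' : P z -> P z' -> P (z + z').
  move=> [x Dx [y Jy ->]] [x' Dx' [y' Jy' ->]].
  exists (x + x'); first exact: DD.
  by exists (y + y'); [exact: JD|rewrite addrACA].
have PM s z : P z -> P (s * z).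
  move=> [x Dx [y Jy ->]]; exists (s * x); first exact: DM.
  by exists (s * y); [exact: JM|rewrite mulrDr].
pose A := lattice_ideal P0 PD PM.
(* The D-component is determined modulo I: absorption gives x = x x' + y' x and x' = x x' + y x',
   and the products y' x and y x' lie in I. *)
have pi_uniq (x y x' y' : L) : D x -> J y -> D x' -> J y' -> x + y = x' + y' ->
    bourne_pi I x = bourne_pi I x'.
  move=> Dx Jy Dx' Jy' e; apply/bourne_piP.
  exists (y * x'); first exact: Jy.
  exists (y' * x); first exact: Jy'.
  have ex : x = x * x' + y' * x by rewrite [y' * x]mulrC -mulrDr -e lat_mulKD.
  have ex' : x' = x * x' + y * x' by rewrite -mulrDl e mulrC lat_mulKD.
  by rewrite {1}ex [in RHS]ex' addrAC.
have decomp (a : subtractive_type A) :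
    exists x, D x /\ exists2 y, J y & subtractive_incl a = x + y.
  by have [x Dx Jx] := subtractive_inclP a; exists x.
have [p pP] := choice decomp.
have lin_h : semilinear_for *:%R (fun a => bourne_pi I (p a)).
  split=> [s a|a b].
    rewrite -linearZ; have [Da [y Jy ea]] := pP a.
    have [Dsa [z Jz esa]] := pP (s *: a).
    apply: (pi_uniq _ z _ (s * y)) => //; [exact: DM|exact: JM|].
    by rewrite -mulrDr -ea -esa.
  rewrite -raddfD; have [Da [y Jy ea]] := pP a.
  have [Db [z Jz eb]] := pP b; have [Dab [w Jw eab]] := pP (a + b).
  apply: (pi_uniq _ w _ (y + z)) => //; [exact: DD|exact: JD|].
  by rewrite addrACA -ea -eb -eab.
have [H HE] := e_injective_extend (linear_pack lin_h) (inj _ (cyclic_bourne I)).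
(* A linear map on S is given by its value at 1, so H is multiplication by k followed by the
   projection. *)
pose k : L := repr (H 1); exists k.
have HE1 z : H z = bourne_pi I (z * k).
  by rewrite -{1}[z]mulr1 [LHS]linearZ -[H 1]bourne_piK -linearZ.
have HE' x y : D x -> J y -> bourne_pi I ((x + y) * k) = bourne_pi I x.
  move=> Dx Jy.
  have Pxy : P (x + y) by exists x => //; exists y.
  pose a : subtractive_type A := exist _ (x + y) (asboolT Pxy).
  have [Da [z Jz ea]] := pP a.
  transitivity (bourne_pi I (p a)); last exact: (pi_uniq _ z _ y).
  by rewrite -[RHS](HE a) [RHS]HE1.
split=> [g Gg|x Dx].
  (* Each g in G lies in J, so the D-component of 0 + g is 0 and g k vanishes modulo I. *)
  apply/bourne_pi_eq0; rewrite -[g]add0r HE' ?raddf0 //.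
  by move=> x Dx; rewrite mulrC; apply: Dx.
have := HE' x 0 Dx J0; rewrite addr0 => /bourne_piP[a Ia [b Ib e]].
exists a => //.
have -> : x * (k + a) = x * (x * k + a) by rewrite !mulrDr mulrA lat_mulxx.
by rewrite e lat_mulKD.
Qed.

End LatticeIdeals.

(** * Finiteness, by way of disjoint sequences *)

(** Odd multiples of 2 ^ i keep valuation i, so each column of indices used below is infinite. *)
Lemma logn_unbounded_fiber (i n0 : nat) :
  exists2 n, logn 2 n = i & (n0 <= n)%N.
Proof.
exists (2 ^ i * (n0.*2.+1))%N.
  rewrite mulnC logn_Gauss ?pfactorK //.
  by rewrite prime_coprime // dvdn2 /= odd_double.
by have := expn_gt0 2 i => /=; nia.
Qed.

Section Finiteness.
Context (d : Order.disp_t) (S : tbDistrLatticeType d).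
Local Notation L := (lattice_semiring S).

Section Complemented.
Hypothesis compl : forall x : L, exists y : L, x * y = 0 /\ x + y = 1.

Let below (s : L) : set L := [set x | x * s = x].

(** An element z strictly between 0 and s and its relative complement c split every w below s as w c
    + w z, so one of the two intervals is infinite. Its top is kept as [ta.1]; the other element is
    split off as [ta.2]. *)
Lemma infinite_below_split (s : L) : infinite_set (below s) ->
  exists ta : L * L, [/\ infinite_set (below ta.1), ta.1 * s = ta.1,
    ta.2 != 0, ta.2 * s = ta.2 & ta.2 * ta.1 = 0].
Proof.
move=> inf_s.
have [z /= [zs /not_orP[z0 zNs]]] :
    exists z, (below s `\` [set 0; s])%classic z.
  by apply/infinite_setN0/infinite_setD => //; apply: finite_set2.
have [y [zy zDy]] := compl z; pose c := s * y.
have cz : c * z = 0 by rewrite /c -mulrA [y * z]mulrC zy mulr0.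
have cs : c * s = c by rewrite /c mulrAC lat_mulxx.
have cDz : c + z = s.
  by rewrite -[z in LHS]zs [z * s]mulrC -mulrDr addrC zDy mulr1.
have c0 : c != 0 by apply/eqP => c0; apply: zNs; rewrite -cDz c0 add0r.
have [fin_z|inf_z] := pselect (finite_set (below z)); last first.
  by exists (z, c).
exists (c, z); split => //=; first move=> fin_c; last by rewrite mulrC.
- apply: inf_s; apply: sub_finite_set (finite_image2 +%R fin_c fin_z) => w ws.
  exists (w * c); first by rewrite /below /= -mulrA lat_mulxx.
  exists (w * z); first by rewrite /below /= -mulrA lat_mulxx.
  by rewrite -mulrDr cDz.
- exact/eqP.
Qed.

(** Splitting repeatedly, [a n] is disjoint from the remainder [s n.+1], under which all later terms
    lie. *)
Lemma infinite_disjoint_seq : infinite_set [set: L] ->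
  exists2 a : nat -> L, forall n, a n != 0 &
    forall m n, m != n -> a m * a n = 0.
Proof.
move=> infL.
have split_ex (s : {s : L | infinite_set (below s)}) :
    exists ta : L * L, [/\ infinite_set (below ta.1), ta.1 * sval s = ta.1,
      ta.2 != 0, ta.2 * sval s = ta.2 & ta.2 * ta.1 = 0].
  exact: infinite_below_split (svalP s).
have [ta taP] := choice split_ex.
have inf1 : infinite_set (below 1).
  by apply: sub_infinite_set infL => x _; rewrite /below /= mulr1.
pose next s : {s : L | infinite_set (below s)} :=
  exist _ (ta s).1 (let: And5 h _ _ _ _ := taP s in h).
pose s n := iter n next (exist _ 1 inf1).
have sE n : sval (s n.+1) = (ta (s n)).1 by [].
pose a n := (ta (s n)).2.
exists a => [n|]; first by rewrite /a; case: (taP (s n)).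
have a_below k m : a (k + m)%N * sval (s m) = a (k + m)%N.
  elim: k m => [|k IHk] m; first by rewrite /a; case: (taP (s m)).
  have [_ decr _ _ _] := taP (s m).
  by rewrite addSnnS -[in LHS]IHk sE -mulrA decr -sE IHk.
suff disj m n : (m < n)%N -> a m * a n = 0.
  move=> m n; case: ltngtP => // [/disj //|/disj mn _].
  by rewrite mulrC.
move=> /subnK <-; rewrite -a_below mulrCA sE.
by have [_ _ _ _ ->] := taP (s m); rewrite mulr0.
Qed.

End Complemented.

Hypothesis inj : forall M : lSemiModType L, cyclic_smod M -> e_injective M.

(** With I = 0, k is the greatest element disjoint from G, and its complement u is the supremum of
    G; the second clause is leastness expressed through disjointness. *)
Lemma cyclic_injective_sup (G : L -> Prop) : exists u : L,
  (forall g, G g -> g * u = g) /\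
  forall t, (forall g, G g -> t * g = 0) -> t * u = 0.
Proof.
have ID (x y : L) : x = 0 -> y = 0 -> x + y = 0 by move=> -> ->; rewrite addr0.
have IM (s x : L) : x = 0 -> s * x = 0 by move=> ->; rewrite mulr0.
have [k [Gk maxk]] := pseudocomplement_modulo inj
  (lattice_ideal (erefl 0) ID IM) G.
have [u [ku kDu]] :=
  complemented_of_e_injective (inj (@cyclic_regular L)) k.
exists u; split=> [g Gg|t tG].
  by rewrite -[RHS]mulr1 -kDu mulrDr (Gk g Gg) add0r.
by have [_ /= -> <-] := maxk t tG; rewrite addr0 -mulrA ku mulr0.
Qed.

Lemma cyclic_injective_no_disjoint_seq (a : nat -> L) :
  (forall n, a n != 0) -> ~ (forall m n, m != n -> a m * a n = 0).
Proof.
move=> a_neq0 disj.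
pose P s := exists n0, forall n, (n0 <= n)%N -> s * a n = 0.
have P0 : P 0 by exists 0%N => n _; rewrite mul0r.
have PD x y : P x -> P y -> P (x + y).
  move=> [m xm] [n yn]; exists (maxn m n) => j; rewrite geq_max => /andP[mj nj].
  by rewrite mulrDl xm ?yn ?addr0.
have PM s x : P x -> P (s * x).
  by move=> [m xm]; exists m => n mn; rewrite -mulrA xm ?mulr0.
pose I := lattice_ideal P0 PD PM.
(* Column i consists of the indices of 2-adic valuation i. *)
pose col i g := exists2 n, logn 2 n = i & g = a n.
have [N NP] := choice (fun i => cyclic_injective_sup (col i)).
have [k [Nk maxk]] := pseudocomplement_modulo inj I
  (fun g => exists i, g = N i).
(* Beyond some bound k annihilates every member of column i, as these lie below [N i]. Asking for i
   <= n makes the choice unbounded in i, which the final contradiction uses. *)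
have diag i : exists n, [/\ logn 2 n = i, (i <= n)%N & a n * k = 0].
  have [n0 Nk0] := Nk _ (ex_intro _ i erefl).
  have [n col_n le_n] := logn_unbounded_fiber i (maxn i n0).
  exists n; split=> //; first by rewrite (leq_trans _ le_n) ?leq_maxl.
  have [Ni_sup _] := NP i; rewrite -[a n]Ni_sup; last by exists n.
  by rewrite -mulrA mulrC Nk0 // (leq_trans _ le_n) ?leq_maxr.
have [f fP] := choice diag.
have [x [fx x_min]] := cyclic_injective_sup (fun g => exists i, g = a (f i)).
have [_ [i ->]|i [n0 i0] xE] := maxk x.
  (* For n beyond [f i], if n is in column i then [a n] is none of the chosen elements, hence
     disjoint from x; otherwise it is disjoint from [N i]. *)
  exists (f i).+1 => n lt_n; rewrite mulrAC.
  have [col_n|col_n] := eqVneq (logn 2 n) i.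
    rewrite [x * _]mulrC x_min ?mul0r // => _ [j ->]; apply: disj.
    apply/eqP => nE; have [colj _ _] := fP j.
    by move: lt_n; rewrite nE -col_n nE colj ltnn.
  have [_ Ni_min] := NP i.
  rewrite -mulrA Ni_min ?mulr0 // => _ [m col_m ->]; apply: disj.
  by apply: contraNneq col_n => ->; rewrite col_m.
(* Here x (k + i) = x, where i annihilates [a n] from n0 on. Both k and i annihilate [a (f n0)],
   which lies below x and so would vanish. *)
have [_ le_f fk] := fP n0.
have /eqP[] := a_neq0 (f n0).
rewrite -[LHS]fx; last by exists n0.
by rewrite -xE mulrA mulrAC mulrDr fk add0r [a _ * i]mulrC i0 ?mul0r.
Qed.

Lemma finite_boolean_of_cyclic_injective : finite_boolean_algebra S.
Proof.
have compl := complemented_of_e_injective (inj (@cyclic_regular L)).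
split; last exact: compl.
apply: contrapT => /(infinite_disjoint_seq compl)[a a0].
exact: cyclic_injective_no_disjoint_seq a0.
Qed.

End Finiteness.

(** * From extension of maps to e-injectivity *)

(** Linear maps out of R are the elements of their target, so the universal property is tested on
    R. *)
Lemma smod_kernel_inj_im (R : comPzSemiRingType) (A B C : lSemiModType R)
    (f : {linear A -> B}) (g : {linear B -> C}) : smod_kernel f g ->
  injective f /\ forall b, g b = 0 -> exists a, f a = b.
Proof.
move=> [gf0 univ]; split=> [a a' faa'|b gb0].
  have [s|u _ u_uniq] := univ _ (f \o scale_by a : {linear R^o -> B}).
    exact: gf0.
  have ua : scale_by a =1 u by apply: u_uniq.
  have ua' : scale_by a' =1 u.
    by apply: u_uniq => s /=; rewrite !linearZ faa'.
  by rewrite -[a]scale1r -[a']scale1r; apply: etrans (ua 1) (esym (ua' 1)).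
have [s|u ub _] := univ _ (scale_by b).
  by rewrite linearZ /= gb0 scaler0.
by exists (u 1); apply: etrans (ub 1) (scale1r b).
Qed.

(** The kernel half comes from the universal property of g. For the cokernel half, k vanishes on A,
    so it factors through g and [psi] kills it; adding k then shows that [psi h] depends only on the
    restriction of h to A. *)
Lemma e_injective_of_extension (R : pzSemiRingType) (M : lSemiModType R) :
  (forall (A B C : lSemiModType R) (f : {linear A -> B}) (g : {linear B -> C}),
     smod_kernel f g ->
     (forall h : {linear A -> M}, exists H : {linear B -> M}, H \o f =1 h) /\
     exists2 k : {linear B -> M}, forall a, k (f a) = 0 &
       forall h h' : {linear B -> M},
         h \o f =1 h' \o f -> forall b, h b + k b = h' b + k b) ->
  e_injective M.
Proof.
move=> ext A B C f g [ker_f [gf0 coker_g]].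
split; split.
- by move=> h; apply: linear_eqP => a /=; rewrite gf0 raddf0.
- move=> X phi phi_f.
  have factor x : exists u : {linear C -> M},
      u \o g =1 (phi x : {linear B -> M}).
    have [a|u uE _] := coker_g M (phi x : {linear B -> M}); last by exists u.
    exact: (congr1 (fun h : smod_hom A M => (h : {linear A -> M}) a) (phi_f x)).
  have g_epi (u v : smod_hom C M) :
      smod_hom_map g u = smod_hom_map g v -> u = v.
    move=> uv.
    have [a|w _ w_uniq] := coker_g M (smod_hom_map g u : {linear B -> M}).
      by rewrite /= gf0 raddf0.
    apply: linear_eqP => c; rewrite (w_uniq u) // (w_uniq v) // => b.
    exact: (congr1 (fun h : smod_hom B M => (h : {linear B -> M}) b) (esym uv)).
  have [u uE] := choice factor.
  have uE' x : smod_hom_map g (u x) = phi x.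
    by apply: linear_eqP => b; apply: uE.
  have add_u : nmod_morphism (u : X -> smod_hom C M).
    split=> [|x y]; apply: g_epi; rewrite uE' ?raddf0 ?raddfD //.
    by rewrite -(uE' x) -(uE' y); apply: linear_eqP.
  exists (additive_pack add_u) => [x|v vE x]; first exact: uE'.
  by apply: g_epi; rewrite [LHS]vE [RHS]uE'.
- by move=> h; apply: linear_eqP => a /=; rewrite gf0 raddf0.
- move=> X psi psi_g.
  have [extend [k kf0 absorb]] := ext _ _ _ _ _ ker_f.
  have psi_f (h h' : smod_hom B M) :
      smod_hom_map f h = smod_hom_map f h' -> psi h = psi h'.
    move=> hh'; have [a|l lg _] := coker_g M k; first exact: kf0.
    have psi_k : psi (k : smod_hom B M) = 0.
      rewrite (_ : (k : smod_hom B M) = smod_hom_map g l).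
        exact: (psi_g (l : smod_hom C M)).
      by apply: linear_eqP => b; rewrite /= -lg.
    rewrite -[LHS]addr0 -[RHS]addr0 -psi_k -!raddfD.
    apply: (congr1 psi); apply: linear_eqP => b; apply: absorb => a.
    exact: (congr1 (fun h : smod_hom A M => (h : {linear A -> M}) a) hh').
  have [H HE] := choice extend.
  have HE' h : smod_hom_map f (H h) = h by apply: linear_eqP => a; apply: HE.
  have add_u : nmod_morphism (fun h : smod_hom A M => psi (H h)).
    split=> [|h h'].
      by rewrite -[RHS](raddf0 psi); apply: psi_f; rewrite HE' raddf0.
    rewrite -raddfD; apply: psi_f; rewrite HE' -{1}(HE' h) -{1}(HE' h').
    by apply: linear_eqP.
  exists (additive_pack add_u) => [h|v vE h].
    by apply: psi_f; rewrite HE'.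
  by rewrite -[h]HE' [LHS]vE /=; apply: psi_f; rewrite !HE'.
Qed.

(** * Atoms and extension of maps over a finite Boolean algebra *)

Section FiniteBoolean.
Context (d : Order.disp_t) (S : tbDistrLatticeType d).
Local Notation L := (lattice_semiring S).

(** The element 0 qualifies too, which leaves sums of such elements unchanged. *)
Definition atomic (e : L) := forall s : L, s * e = e \/ s * e = 0.

Lemma finite_boolean_atoms : finite_boolean_algebra S ->
  exists2 E : seq L, {in E, forall e, atomic e} & \sum_(e <- E) e = 1.
Proof.
move=> [/finite_seqP[r rP] compl].
have r_all (s : L) : s \in r by have : [set` r]%classic s by rewrite -rP.
have atom_below (y : L) : y != 0 -> exists e, [/\ e != 0, e * y = e & atomic e].
  move=> y0.
  suff [e [e0 ey er]] : exists e, [/\ e != 0, e * y = e &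
      {in r, forall s, s * e = e \/ s * e = 0}].
    by exists e; split=> // s; apply: er.
  (* Running through the list, e is met with s whenever the result is nonzero; the alternatives
     already settled persist. *)
  elim: (r : seq L) => [|s r' [e [e0 ey er]]].
    by exists y; rewrite lat_mulxx; split.
  have [se0|se_neq0] := eqVneq (s * e) 0.
    exists e; split=> // t; rewrite in_cons.
    by move=> /predU1P[->|]; [right|exact: er].
  exists (s * e); split=> //; first by rewrite -mulrA ey.
  move=> t; rewrite in_cons => /predU1P[->|/er [] te].
  - by left; rewrite mulrA lat_mulxx.
  - by left; rewrite mulrCA te.
  - by right; rewrite mulrCA te mulr0.
pose E : seq L := [seq e <- (r : seq L) | `[< atomic e >]].
exists E => [e|]; first by rewrite mem_filter => /andP[/asboolP].
set t := \sum_(e <- E) e.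
(* A nonzero complement y of t would lie above an atom, which is also below t. *)
have [y [ty tDy]] : exists y : L, t * y = 0 /\ t + y = 1 := compl t.
suff y0 : y = 0 by rewrite -tDy y0 addr0.
apply/eqP/negPn/negP => /atom_below[e [/eqP e0 ey e_atom]]; apply: e0.
have eE : e \in E by rewrite mem_filter r_all andbT; apply/asboolP.
have et : e * t = e.
  by rewrite /t (perm_big _ (perm_to_rem eE)) big_cons lat_mulKD.
by rewrite -ey -et -mulrA ty mulr0.
Qed.

Lemma fingen_top (M : lSemiModType L) :
  fingen_smod M -> exists T : M, forall m, m + T = T.
Proof.
move=> [n [p p_surj]]; exists (p [ffun=> 1]) => m.
have [x <-] := p_surj m; rewrite -raddfD; congr (p _).
by apply/ffunP => i; rewrite !ffunE addrC; apply: lat_add1x.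
Qed.

Section AtomwiseExtension.
Context (M A B C : lSemiModType L) (f : {linear A -> B}) (g : {linear B -> C}).
Context (T : M) (E : seq L) (w : B -> A).
Hypotheses (f_inj : injective f) (wK : forall b, g b = 0 -> f (w b) = b).
Hypotheses (T_top : forall m : M, m + T = T).
Hypothesis E_atom : {in E, forall e, atomic e}.

(** The preimages given by [w] are meaningful only on the kernel of g; elsewhere e T, the greatest
    element of e M, is an absorbing default. *)
Definition atomwise (c : {linear A -> M}) (b : B) : M :=
  \sum_(e <- E) if g (e *: b) == 0 then c (w (e *: b)) else e *: T.

Lemma atomwise_linear (c : {linear A -> M}) : semilinear_for *:%R (atomwise c).
Proof.
have wZ s b : g b = 0 -> w (s *: b) = s *: w b.
  by move=> gb0; apply: f_inj; rewrite linearZ /= !wK // linearZ /= gb0 scaler0.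
have w0 : w 0 = 0 by rewrite -(scale0r 0) wZ ?raddf0 // scale0r.
have wD b b' : g b = 0 -> g b' = 0 -> w (b + b') = w b + w b'.
  move=> gb gb'; apply: f_inj; rewrite linearD (wK gb) (wK gb') wK //.
  by rewrite linearD gb gb' addr0.
have TD (e : L) (b : B)
    (m := if g (e *: b) == 0 then c (w (e *: b)) else e *: T) : m + e *: T = e *: T.
  suff <- : e *: m = m by rewrite -scalerDr T_top.
  rewrite /m; case: eqP => [gb0|_]; last by rewrite scalerA lat_mulxx.
  by rewrite -linearZ -wZ // scalerA lat_mulxx.
split=> [s b|b b'].
  (* As s e is e or 0, scaling by s leaves the summand at e unchanged or makes it 0. *)
  rewrite /atomwise scaler_sumr; apply: eq_big_seq => e /E_atom/(_ s).
  rewrite scalerA [e * s]mulrC => -[se|se0].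
    rewrite se; case: eqP => [gb0|_]; last by rewrite scalerA se.
    by rewrite -linearZ -wZ // scalerA se.
  rewrite se0 scale0r raddf0 eqxx w0 raddf0; case: eqP => [gb0|_].
    by rewrite -linearZ -wZ // scalerA se0 scale0r w0 raddf0.
  by rewrite scalerA se0 scale0r.
rewrite /atomwise -big_split /=; apply: eq_bigr => e _.
(* Addition is idempotent, so g vanishes at e (b + b') only if it vanishes at e b and at e b';
   otherwise both sides equal e T. *)
have [gb|gb] := eqVneq (g (e *: b)) 0; last first.
  rewrite [RHS]addrC TD ifN //; apply: contraNneq gb.
  by rewrite scalerDr linearD => /smod_eq0_add ->.
have [gb'|gb'] := eqVneq (g (e *: b')) 0; last first.
  have := TD e b; rewrite gb eqxx => ->.
  by rewrite scalerDr linearD gb add0r ifN.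
by rewrite scalerDr linearD gb gb' addr0 eqxx wD // linearD.
Qed.

End AtomwiseExtension.

Lemma fingen_e_injective (M : lSemiModType L) :
  finite_boolean_algebra S -> fingen_smod M -> e_injective M.
Proof.
move=> /finite_boolean_atoms[E E_atom E_sum] /fingen_top[T T_top].
apply: e_injective_of_extension => A B C f g ker_f.
have [f_inj f_im] := smod_kernel_inj_im ker_f.
have gf0 := ker_f.1.
have lift b : exists a, g b = 0 -> f a = b.
  by have [/f_im[a]|] := pselect (g b = 0); [exists a|exists 0].
have [w wK] := choice lift.
pose H c := linear_pack (atomwise_linear f_inj wK T_top E_atom c).
have sumE (b : B) : b = \sum_(e <- E) e *: b.
  by rewrite -scaler_suml E_sum scale1r.
have HE c a : H c (f a) = c a.
  rewrite [in RHS](_ : a = \sum_(e <- E) e *: a); last first.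
    by rewrite -scaler_suml E_sum scale1r.
  rewrite raddf_sum; apply: eq_bigr => e _; rewrite -linearZ gf0 eqxx.
  by congr (c _); apply: (f_inj); rewrite wK.
split=> [h|]; first by exists (H h) => a; apply: HE.
(* Where g (e b) = 0, e b comes from A and the two maps agree; elsewhere e T absorbs both values. *)
exists (H \0) => [a|h h' hh' b]; first exact: HE.
have absorbE (k : {linear B -> M}) : k b + H \0 b = \sum_(e <- E)
    (k (e *: b) + if g (e *: b) == 0 then 0 else e *: T).
  by rewrite {1}(sumE b) linear_sum -big_split.
rewrite !absorbE; apply: eq_bigr => e _; case: eqP => [/f_im[a <-]|_].
  by rewrite [h _]hh'.
have kE (k : {linear B -> M}) : k (e *: b) = e *: k (e *: b).
  by rewrite -linearZ scalerA lat_mulxx.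
by rewrite (kE h) (kE h') -!scalerDr !T_top.
Qed.

End FiniteBoolean.

Theorem theorem6p5 (d : Order.disp_t) (S : tbDistrLatticeType d) :
  [<-> forall M : lSemiModType (lattice_semiring S),
         fingen_smod M -> e_injective M;
       forall M : lSemiModType (lattice_semiring S),
         cyclic_smod M -> e_injective M;
       finite_boolean_algebra S].
Proof.
tfae.
- move=> inj M [p p_surj]; apply: inj.
  have lin_q : semilinear_for *:%R
      (fun x : {ffun 'I_1 -> (lattice_semiring S)^o} => p (x ord0)).
    by split=> [s x|x y]; rewrite ffunE ?linearZ ?linearD.
  exists 1%N, (linear_pack lin_q) => m; have [s <-] := p_surj m.
  by exists [ffun=> s]; rewrite /= ffunE.
- exact: finite_boolean_of_cyclic_injective.
- by move=> finS M; apply: fingen_e_injective.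
Qed.
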